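(* Start from the empty quadtree configuration and process a valid, aligned sequence of requests with the First Fit strategy. Then: (1) every insertion request is fulfilled at zero cost, i.e., when an $\ell$-square is to be inserted there is an empty $\ell$-pixel and no square is moved; (2) every deletion request is fulfilled (the deletion procedure terminates); (3) after every request the configuration satisfies the invariant: for every $i\in\mathbb{N}_0$ and every empty $i$-pixel $p$ there is no occupied $i$-pixel $q$ with $z(q)>z(p)$.
   Context: The unit square $[0,1]^2$ is recursively subdivided as a quadtree of unbounded depth: the root (layer $0$) is $[0,1]^2$, and every node (pixel) of layer $j$ is an axis-parallel square of side $2^{-j}$ whose four children are its four quadrants. A pixel of layer $j$ is a $j$-pixel. For $r\in\mathbb{N}_0$, an $r$-square is an axis-parallel square of side $2^{-r}$. A (quadtree) configuration assigns finitely many squares to pixels, each $j$-square to a $j$-pixel, at most one square per pixel, such that no pixel with an assigned square is a proper descendant of another pixel with an assigned square. A pixel contains a square if it is assigned to it or to a descendant. A pixel with an assigned square is occupied; a non-occupied pixel is blocked if some ancestor is occupied, free otherwise; a free pixel is empty if it contains no square; an empty pixel is maximally empty if its parent is not empty (an empty root counts as maximally empty). A move reassigns a $j$-square from its $j$-pixel to a $j$-pixel that is empty before the move. Z-order: the four children of every pixel are given the fixed z-curve (Morton) order (top-left, top-right, bottom-left, bottom-right); for pixels $p,q$ neither a descendant of the other, $z(p)<z(q)$ iff at their lowest common ancestor the child containing $p$ precedes the child containing $q$. Requests: $\textsc{Insert}(x)$ or $\textsc{Delete}(x)$, $x$ a unique identifier of a square of volume $v$ (deletions refer to present squares); volume $v$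 resp. $-v$. A sequence $\sigma_1,\dots,\sigma_k$ is valid if all prefix sums of volumes are $\le 1$ and aligned if each $|\mathrm{vol}(\sigma_j)|=4^{-\ell_j}$, $\ell_j\in\mathbb{N}_0$. The cost of a request is measured by the squares moved while fulfilling it. First Fit: an insertion of an $i$-square is handled by assigning it to the first empty $i$-pixel in z-order. A deletion of a square assigned to pixel $p$ unassigns it and then runs: set $S\gets\{p'\}$ with $p'$ the maximally empty pixel containing $p$; while $S\neq\varnothing$: let $a$ be the element of $S$ first in z-order, remove $a$ from $S$, let $b$ be the last occupied pixel in z-order; while $z(b)>z(a)$: if the square $B$ assigned to $b$ can be packed into $a$ (i.e., $a$ has an empty descendant, or is itself, a pixel of $B$'s layer), assign $B$ to the first such empty pixel inside $a$ in z-order, unassign $B$ from $b$, let $b'$ be the maximally empty pixel containing $b$, add $b'$ to $S$ and remove all children of $b'$ from $S$; then replace $b$ by the previous occupied pixel in z-order. *)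

(* Defs.v *)
From HB Require Import structures.
From mathcomp Require Import all_boot all_order all_algebra.
From mathcomp Require Import finmap.
From Stdlib Require Export Relation_Operators.

Set Implicit Arguments.
Unset Strict Implicit.
Unset Printing Implicit Defensive.

Import Order.TTheory GRing.Theory Num.Theory.

Local Open Scope ring_scope.
Local Open Scope fset_scope.
Local Open Scope fmap_scope.

(* A pixel is the path of quadrants that leads to it from the root [::], with
   0, 1, 2, 3 standing for the top-left, top-right, bottom-left and
   bottom-right quadrant.  The children of p are the pixels rcons p d, and
   prefix p q says that q is p or a descendant of p. *)
Definition pixel := seq 'I_4.

Definition layer (p : pixel) : nat := size p.

Definition children (p : pixel) : {fset pixel} := [fset rcons p d | d in 'I_4].

(* m is the lowest common ancestor of p and q; pixels one of which descends
   from the other are not comparable. *)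
Definition zlt (p q : pixel) : Prop :=
  exists (m : pixel) (i j : 'I_4) (s t : pixel),
    [/\ p = m ++ i :: s, q = m ++ j :: t & (i < j)%N].

Definition z_first (P : pixel -> Prop) (p : pixel) : Prop :=
  P p /\ forall q, P q -> ~ zlt q p.

Definition z_last (P : pixel -> Prop) (p : pixel) : Prop :=
  P p /\ forall q, P q -> ~ zlt p q.

Definition z_last_opt (P : pixel -> Prop) (op : option pixel) : Prop :=
  if op is Some p then z_last P p else forall q, ~ P q.

Section Squares.
Variables (R : realFieldType) (ID : choiceType) (side : ID -> R).

Definition volume (x : ID) : R := side x ^+ 2.

Definition is_square (r : nat) (x : ID) : Prop := side x = 2 ^- r.

Inductive request := Insert of ID | Delete of ID.

Definition request_volume (r : request) : R :=
  match r with Insert x => volume x | Delete x => - volume x end.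

Definition present (s : seq request) : {fset ID} :=
  foldl (fun A r => match r with Insert x => x |` A | Delete x => A `\ x end)
    fset0 s.

Definition refers_properly (s : seq request) (r : request) : Prop :=
  match r with
  | Insert x => x \notin present s
  | Delete x => x \in present s
  end.

Definition valid (reqs : seq request) : Prop :=
  (forall s r t, reqs = s ++ r :: t -> refers_properly s r) /\
  (forall k, \sum_(r <- take k reqs) request_volume r <= 1).

Definition aligned (reqs : seq request) : Prop :=
  forall s r t, reqs = s ++ r :: t ->
    exists l : nat, `|request_volume r| = 4 ^- l.

Definition config := {fmap pixel -> ID}.

Definition occupied (c : config) (p : pixel) : Prop := p \in domf c.

Definition is_configuration (c : config) : Prop :=
  [/\ forall p x, c.[? p] = Some x -> is_square (layer p) x,
      forall p q x, c.[? p] = Some x -> c.[? q] = Some x -> p = q &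
      forall p q, occupied c p -> occupied c q -> prefix p q -> p = q].

Definition contains_square (c : config) (p : pixel) : Prop :=
  exists q, prefix p q /\ occupied c q.

Definition blocked (c : config) (p : pixel) : Prop :=
  ~ occupied c p /\ exists q, [/\ prefix q p, q <> p & occupied c q].

Definition free_pixel (c : config) (p : pixel) : Prop :=
  ~ occupied c p /\ ~ blocked c p.

Definition empty (c : config) (p : pixel) : Prop :=
  free_pixel c p /\ ~ contains_square c p.

Definition maximally_empty (c : config) (p : pixel) : Prop :=
  empty c p /\ forall q d, p = rcons q d -> ~ empty c q.

Definition packing_place (c : config) (a : pixel) (l : nat) (q : pixel) : Prop :=
  [/\ prefix a q, layer q = l & empty c q].

Definition ff_insert (c : config) (x : ID) (c' : config) : Prop :=
  exists l p, [/\ is_square l x,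
    z_first (fun q => layer q = l /\ empty c q) p & c' = c.[p <- x]].

(* Control states of the deletion procedure: about to delete x, at the test
   of the outer loop, and at the test of the inner loop; in the last case the
   final component is None when there is no occupied pixel left to consider. *)
Inductive state :=
  | Begin of config & ID
  | Outer of config & {fset pixel}
  | Inner of config & {fset pixel} & pixel & option pixel.

(* S may contain a pixel together with one of its descendants, since only the
   children of b' are removed from it.  The z-order does not compare the two,
   and step_outer may then select either of them. *)
Inductive step : state -> state -> Prop :=
  | step_begin (c : config) (x : ID) (p p' : pixel) :
      c.[? p] = Some x ->
      maximally_empty c.[~ p] p' -> prefix p' p ->
      step (Begin c x) (Outer c.[~ p] [fset p'])
  | step_outer (c : config) (S : {fset pixel}) (a : pixel) (ob : option pixel) :
      z_first (fun s => s \in S) a ->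
      z_last_opt (occupied c) ob ->
      step (Outer c S) (Inner c (S `\ a) a ob)
  | step_pack (c c' : config) (S : {fset pixel}) (a b : pixel) (B : ID)
      (q b' : pixel) (ob : option pixel) :
      zlt a b -> c.[? b] = Some B ->
      z_first (packing_place c a (layer b)) q ->
      c' = c.[q <- B].[~ b] ->
      maximally_empty c' b' -> prefix b' b ->
      z_last_opt (fun p => occupied c' p /\ zlt p b) ob ->
      step (Inner c S a (Some b))
           (Inner c' ((b' |` S) `\` children b') a ob)
  | step_skip (c : config) (S : {fset pixel}) (a b : pixel)
      (ob : option pixel) :
      zlt a b ->
      (forall q, ~ packing_place c a (layer b) q) ->
      z_last_opt (fun p => occupied c p /\ zlt p b) ob ->
      step (Inner c S a (Some b)) (Inner c S a ob)
  | step_exit (c : config) (S : {fset pixel}) (a : pixel) (ob : option pixel) :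
      (forall b, ob = Some b -> ~ zlt a b) ->
      step (Inner c S a ob) (Outer c S).

(* Every execution from the state is finite and ends at the exit of the outer
   loop. *)
Inductive terminates : state -> Prop :=
  | terminates_exit c : terminates (Outer c fset0)
  | terminates_step st :
      (exists st', step st st') ->
      (forall st', step st st' -> terminates st') ->
      terminates st.

Definition ff_delete (c : config) (x : ID) (c' : config) : Prop :=
  clos_refl_trans state step (Begin c x) (Outer c' fset0).

Definition ff_request (c : config) (r : request) (c' : config) : Prop :=
  match r with
  | Insert x => ff_insert c x c'
  | Delete x => ff_delete c x c'
  end.

Inductive ff_run : seq request -> config -> Prop :=
  | ff_run_nil : ff_run [::] [fmap]
  | ff_run_rcons s c r c' :
      ff_run s c -> ff_request c r c' -> ff_run (rcons s r) c'.

Definition no_square_moved (c c' : config) : Prop :=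
  forall p x, c.[? p] = Some x -> c'.[? p] = Some x.

Definition ff_invariant (c : config) : Prop :=
  forall (i : nat) (p : pixel), layer p = i -> empty c p ->
    ~ exists q, [/\ layer q = i, occupied c q & zlt p q].

End Squares.

(* Main.v *)
(* Call a pair of an empty pixel p and an occupied pixel q of the same layer a
   violation if p precedes q.  Without violations, the empty pixels of layer
   j + 1 whose parent is not empty are at most three siblings, so the numbers
   N_j of empty j-pixels satisfy N_(j+1) <= 4 N_j + 3.  Hence, if no l-pixel is
   empty, then the free area is less than 4^-l, and a valid insertion finds room.

   During a deletion, every violation (p, q) has p inside a pixel of S that
   precedes q, or inside a with q still to be considered.  Packing into a could
   break this only if a lies strictly inside a pixel of S.  Such an a is dead:
   every later square is too large for it.  Indeed, the free area before a
   square never grows when squares move forward, and once the first run of the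
   inner loop has passed a square of layer l, this area is less than 2 * 4^-l:
   less than 4^-l was free before the deletion, and less than 4^-l is left in
   the pixel into which the square did not fit.  So a freed pixel b' is no
   larger than any later square, and a pixel strictly inside b' is smaller.

   Every packing moves a square to an earlier pixel of its layer, which bounds
   the number of packings. *)

Require Import Defs.
From mathcomp Require Import all_boot all_order all_algebra.
From mathcomp Require Import finmap zify.
From Stdlib Require Import Operators_Properties.

Set Implicit Arguments.
Unset Strict Implicit.
Unset Printing Implicit Defensive.

(** * The z-order *)

(** The first quadrant in which two paths differ is the branch below their lowest common ancestor.
    Running out of one path means that the pixels are nested, hence [false]. *)
Fixpoint zltb (p q : pixel) : bool :=
  match p, q with
  | i :: s, j :: t => (i < j) || (i == j) && zltb s t
  | _, _ => false
  end.

Definition nested (p q : pixel) : bool := prefix p q || prefix q p.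

Lemma zltP (p q : pixel) : reflect (zlt p q) (zltb p q).
Proof.
apply: (iffP idP) => [|[m [i [j [s [t [-> -> ij]]]]]]]; last first.
  by elim: m => [|k m IHm] /=; rewrite ?ij // eqxx IHm orbT.
elim: p q => [|i s IHs] [|j t] //= /orP[ij|/andP[/eqP<- /IHs]].
  by exists [::], i, j, s, t.
by case=> m [a [b [u [v [-> -> ab]]]]]; exists (i :: m), a, b, u, v.
Qed.

Lemma zltb_trans : transitive zltb.
Proof.
move=> q p r; elim: p q r => [|i s IHs] [|j t] [|k u] //=.
case/orP=> [ij|/andP[/eqP-> st]] /orP[jk|/andP[/eqP<- tu]].
- by rewrite (ltn_trans ij jk).
- by rewrite ij.
- by rewrite jk.
- by rewrite eqxx (IHs _ _ st tu) orbT.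
Qed.

Lemma zltbxx (p : pixel) : zltb p p = false.
Proof. by elim: p => //= i s ->; rewrite ltnn andbF. Qed.

Lemma zltb_asym (p q : pixel) : zltb p q -> zltb q p = false.
Proof. by move=> pq; apply/negP => /(zltb_trans pq); rewrite zltbxx. Qed.

Lemma nestedC (p q : pixel) : nested p q = nested q p.
Proof. by rewrite /nested orbC. Qed.

Lemma nested_refl (p : pixel) : nested p p.
Proof. by rewrite /nested prefix_refl. Qed.

(** Either two paths differ at some first quadrant, which decides the z-order, or one is a prefix of
    the other. *)
Lemma nestedE (p q : pixel) : nested p q = ~~ (zltb p q || zltb q p).
Proof.
elim: p q => [|i s IHs] [|j t]; rewrite /nested ?prefix0s ?prefixs0 //=.
rewrite ?prefix_cons [j == i]eq_sym; move: (IHs t); rewrite /nested.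
have [->|] := eqVneq i j; first by rewrite ltnn.
rewrite -val_eqE neq_ltn /=; by case/orP=> ->; rewrite ?orbT.
Qed.

Lemma zltb_not_nested (p q : pixel) : zltb p q -> nested p q = false.
Proof. by rewrite nestedE => ->. Qed.

Lemma zltb_prefixl (p p' q : pixel) : prefix p p' -> zltb p q -> zltb p' q.
Proof.
case/prefixP=> s ->; elim: p q => [|i u IHu] [|j t] //=.
by case/orP=> [->//|/andP[-> /IHu->]]; rewrite orbT.
Qed.

Lemma zltb_prefixr (p q q' : pixel) : prefix q q' -> zltb p q -> zltb p q'.
Proof.
case/prefixP=> s ->; elim: p q => [|i u IHu] [|j t] //=.
by case/orP=> [->//|/andP[-> /IHu->]]; rewrite orbT.
Qed.

Lemma nested_prefix (p p' q : pixel) :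
  prefix p p' -> nested p' q -> nested p q.
Proof.
move=> pp'; rewrite !nestedE; apply: contra => /orP[/(zltb_prefixl pp')->//|].
by move/(zltb_prefixr pp')=> ->; rewrite orbT.
Qed.

Lemma prefix_total (p q r : pixel) : prefix p r -> prefix q r -> nested p q.
Proof.
move=> pr qr; apply: (nested_prefix pr).
by rewrite /nested qr orbT.
Qed.

(** The ancestor [p] cannot come after [q], since [p'] would too. So it precedes [q] or is nested
    with it, and below [q] it would drag [p'] there. *)
Lemma zltb_ancestorl (p p' q : pixel) :
  prefix p p' -> zltb p' q -> zltb p q || prefix p q.
Proof.
move=> pp' p'q; have /negbT := zltb_not_nested p'q; rewrite /nested => /norP[_ Nqp'].
have : ~~ zltb q p by apply/negP => /(zltb_prefixr pp'); rewrite (zltb_asym p'q).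
have [//|Npq Nqp] := boolP (zltb p q).
have : nested p q by rewrite nestedE negb_or Npq.
by case/orP=> // /prefix_trans/(_ pp'); rewrite (negbTE Nqp').
Qed.

Lemma zltb_ancestorr (p q q' : pixel) :
  prefix q q' -> zltb p q' -> zltb p q || prefix q p.
Proof.
move=> qq' pq'; have /negbT := zltb_not_nested pq'; rewrite /nested => /norP[Npq' _].
have : ~~ zltb q p by apply/negP => /(zltb_prefixl qq'); rewrite (zltb_asym pq').
have [//|Npq Nqp] := boolP (zltb p q).
have : nested p q by rewrite nestedE negb_or Npq.
by case/orP=> // /prefix_trans/(_ qq'); rewrite (negbTE Npq').
Qed.

Lemma prefix_size_eq (p q : pixel) : prefix p q -> size q <= size p -> p = q.
Proof.
case/prefixP=> s ->; rewrite size_cat -[leqRHS]addn0 leq_add2l leqn0 size_eq0.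
by move/eqP->; rewrite cats0.
Qed.

Lemma prefix_rconsr (p q : pixel) d : prefix p (rcons q d) -> p != rcons q d -> prefix p q.
Proof.
move=> pq; rewrite prefixE in pq; move: pq => /eqP pq Npq.
have lepq: size p <= size q.
  rewrite leqNgt; apply: contra Npq => ltpq.
  by rewrite -pq take_oversize // size_rcons.
by rewrite prefixE -[X in _ == X]pq -cats1 takel_cat.
Qed.

Lemma nested_size_inj (p q : pixel) : size p = size q -> nested p q -> p = q.
Proof.
move=> pq /orP[] /prefix_size_eq; first by rewrite pq; apply.
by move=> ->; rewrite ?pq.
Qed.

Section Extremum.
Variables (r : rel pixel).
Hypotheses (r_irr : irreflexive r) (r_trans : transitive r).

Lemma seq_extremum (s : seq pixel) : s != [::] ->
  exists2 a, a \in s & forall t, t \in s -> ~~ r t a.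
Proof.
elim: s => // x s IHs _; have [->|/IHs[a as_ amin]] := eqVneq s [::].
  by exists x; rewrite ?inE // => t; rewrite inE => /eqP->; rewrite r_irr.
have [rxa|Nrxa] := boolP (r x a).
  exists x; rewrite ?inE ?eqxx // => t; rewrite inE => /predU1P[->|ts].
    by rewrite r_irr.
  by apply: contra (amin t ts) => /r_trans; apply.
by exists a; rewrite ?inE ?as_ ?orbT // => t; rewrite inE => /predU1P[->|/amin].
Qed.

End Extremum.

Lemma exists_z_first (P : pred pixel) (l : nat) :
  (exists2 p, size p = l & P p) -> exists p, z_first (fun q => layer q = l /\ P q) p.
Proof.
case=> p pl Pp; pose s := [seq q <- map val (enum {: l.-tuple 'I_4}) | P q].
have sP q : q \in s = (size q == l) && P q.
  rewrite mem_filter andbC; congr (_ && _); apply/mapP/eqP => [[t _ ->]|ql].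
    by rewrite size_tuple.
  by move/eqP: ql => ql; exists (Tuple ql); rewrite ?mem_enum.
have /(seq_extremum zltbxx zltb_trans)[a] : s != [::].
  by apply/eqP => s0; have := sP p; rewrite s0 pl eqxx Pp.
rewrite sP => /andP[/eqP al Pa] amin; exists a; split=> // q [ql Pq].
by move/zltP; apply/negP/amin; rewrite sP Pq andbT; apply/eqP.
Qed.

(** The path read as a base-4 numeral, that is, the position of the pixel within its layer. The sum
    over the occupied pixels drops with every packing. *)
Fixpoint zrank (p : pixel) : nat :=
  if p is d :: s then d * 4 ^ size s + zrank s else 0.

Lemma zrank_lt (p : pixel) : zrank p < 4 ^ size p.
Proof.
elim: p => //= d s IHs; rewrite expnS (leq_trans (_ : _ < d.+1 * 4 ^ size s)) //.
  by rewrite mulSn addnC ltn_add2r.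
by rewrite leq_mul2r ltn_ord orbT.
Qed.

Lemma zrank_mono (p q : pixel) : size p = size q -> zltb p q -> zrank p < zrank q.
Proof.
elim: p q => [|i s IHs] [|j t] //= [st] /orP[ij|/andP[/eqP<- /(IHs _ st) lts]].
  apply: (@leq_trans (i.+1 * 4 ^ size s)).
    by rewrite mulSn [_ + _ * _]addnC ltn_add2l zrank_lt.
  by apply: leq_trans (leq_addr _ _); rewrite -st leq_mul2r ij orbT.
by rewrite st ltn_add2l.
Qed.

(** * Free area *)

Lemma card_tuple_prefix (D : nat) (p : pixel) : size p <= D ->
  #|[set w : D.-tuple 'I_4 | prefix p w]| = 4 ^ (D - size p).
Proof.
move/subnKC; move: (D - size p) => k; case: _ /.
rewrite -[X in X ^ _](card_ord 4) -card_tuple.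
pose f (t : k.-tuple 'I_4) := [tuple of in_tuple p ++ t].
have f_inj : injective f.
  move=> t u /(congr1 val) /= /eqP; rewrite eqseq_cat // => /andP[_ /eqP tu].
  exact: val_inj.
rewrite -(card_imset _ f_inj); apply: eq_card => w; rewrite inE.
apply/prefixP/imsetP => [[s ws]|[t _ ->]]; last by exists t.
have szs : size s == k.
  by have /eqP := size_tuple w; rewrite ws size_cat eqn_add2l.
by exists (Tuple szs) => //; apply: val_inj.
Qed.

Section Configurations.
Variable ID : choiceType.
Implicit Types (c : config ID) (p q : pixel).

(** Nestedness with an occupied pixel covers all obstacles at once: being occupied, being blocked
    from above, and containing a square. *)
Definition emptyb c p : bool := all (fun q => ~~ nested p q) (domf c).

Lemma emptyb_nested c p q : emptyb c p -> q \in domf c -> nested p q = false.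
Proof. by move=> /allP/[apply]/negbTE. Qed.

Lemma emptybP c p : reflect (empty c p) (emptyb c p).
Proof.
apply: (iffP idP) => [cp|[[Nocc Nbl] Ncont]].
  split; first split=> [pc|[_ [q [qp _ qc]]]]; last case=> q [pq qc].
  - by have := emptyb_nested cp pc; rewrite nested_refl.
  - by have := emptyb_nested cp qc; rewrite /nested qp orbT.
  - by have := emptyb_nested cp qc; rewrite /nested pq.
apply/allP => q qc; apply/negP => /orP[pq|qp]; first by apply: Ncont; exists q.
apply: Nbl; split=> //; exists q; split=> // qEp.
by apply: Nocc; rewrite -qEp.
Qed.

Lemma emptyb_prefix c p q : prefix p q -> emptyb c p -> emptyb c q.
Proof.
move=> pq /allP cp; apply/allP => r rc; apply: contra (cp r rc).
exact: nested_prefix.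
Qed.

Lemma emptyb_notin c p : emptyb c p -> p \notin domf c.
Proof. by move=> cp; apply/negP => /(emptyb_nested cp); rewrite nested_refl. Qed.

Lemma maximally_emptyP c p : emptyb c p ->
  exists p', maximally_empty c p' /\ prefix p' p.
Proof.
elim/last_ind: p => [|p d IHp] cp.
  exists [::]; split=> //; split; first exact/emptybP.
  by move=> q d; case: q.
have [/IHp[p' [maxp' p'p]]|Ncp] := boolP (emptyb c p).
  by exists p'; split=> //; apply: prefix_trans p'p (prefix_rcons _ _).
exists (rcons p d); split; last exact: prefix_refl.
split=> [|q e /rcons_inj[<- _]]; first exact/emptybP.
by move/emptybP; apply/negP.
Qed.

(** If [q] is above [p], then [q] and [p'] both contain [p]; a [q] strictly above [p'] would make
    the parent of [p'] empty. Hence all space freed along with [p] lies inside [p']. *)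
Lemma maximally_empty_prefix c p p' q :
  maximally_empty c p' -> prefix p' p -> emptyb c q -> nested q p -> prefix p' q.
Proof.
move=> [_ maxp'] p'p cq /orP[qp|]; last exact: prefix_trans.
have /orP[qp'|//] := prefix_total qp p'p.
case/lastP: p' => [|p' d] in maxp' p'p qp' *; first exact: prefix0s.
have [->|Nq] := eqVneq q (rcons p' d); first exact: prefix_refl.
case: (maxp' p' d) => //; apply/emptybP/emptyb_prefix/cq.
exact: prefix_rconsr qp' Nq.
Qed.

Definition antichain c : Prop :=
  forall p q, p \in domf c -> q \in domf c -> prefix p q -> p = q.

Lemma antichain_zltb c p q : antichain c -> p \in domf c -> q \in domf c ->
  [|| p == q, zltb p q | zltb q p].
Proof.
move=> ac pc qc; have [pq|Npq] := boolP (nested p q); last first.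
  by move: Npq; rewrite nestedE negbK => ->; rewrite orbT.
by case/orP: pq => /ac->; rewrite ?eqxx.
Qed.

(** The free area of the region [rg] in units of one pixel of layer [D], provided that no square
    lies deeper than [D]. *)
Definition free_count (D : nat) c (rg : pred pixel) : nat :=
  #|[set w : D.-tuple 'I_4 | emptyb c w && rg w]|.

Lemma free_count_le (D : nat) c c' (rg rg' : pred pixel) :
  (forall w, emptyb c w -> rg w -> emptyb c' w && rg' w) ->
  free_count D c rg <= free_count D c' rg'.
Proof.
by move=> sub; apply/subset_leq_card/subsetP => w; rewrite !inE => /andP[/sub/[apply]].
Qed.

Lemma free_count_split (D : nat) c (rg a : pred pixel) :
  free_count D c rg <=
  free_count D c (fun w => a w && rg w) + free_count D c (fun w => rg w && ~~ a w).
Proof.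
apply: leq_trans (leq_card_setU _ _); apply/subset_leq_card/subsetP => w.
by rewrite !inE => /andP[-> ->] /=; rewrite andbT orbN.
Qed.

(* The empty pixels of layer j+1 whose parent is not an empty pixel of the
   region are siblings, and not all four of them are empty. *)
Lemma free_count_lt c (rg : pred pixel) (l D : nat) :
  (forall x y, prefix x y -> rg x -> rg y) ->
  (forall p d, emptyb c (rcons p d) -> rg (rcons p d) -> l <= size p -> rg p) ->
  (forall p r x, emptyb c p -> rg p -> r \in domf c -> size p = size r ->
     zltb p r -> prefix x r -> rg x -> False) ->
  (forall p, size p = l -> rg p -> ~~ emptyb c p) ->
  l <= D -> free_count D c rg < 4 ^ (D - l).
Proof.
move=> rg_down rg_up inv full /subnKC; move: (D - l) => k <- {D}.
(* At layer [l] the count is 0, and [N <= 4 ^ k - 1] turns into [4 * N + 3 <= 4 ^ k.+1 - 1] one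
   layer further down. *)
elim: k => [|k]; rewrite ?addn0 ?addnS.
  rewrite ltnS leqn0 cards_eq0; apply/eqP/setP => w; rewrite !inE.
  by apply/negP => /andP[cw /(full _ (size_tuple w))]; rewrite cw.
set j := l + k; rewrite /free_count.
set E := [set w : j.-tuple _ | _]; set E' := [set w : j.+1.-tuple _ | _] => ltE.
pose ch (u : j.-tuple 'I_4 * 'I_4) := [tuple of rcons u.1 u.2].
pose F := [set ch u | u in setX E [set: 'I_4]].
have chP (w : j.+1.-tuple 'I_4) : exists u, w = ch u.
  case/lastP Dw: (tval w) => [|p d]; first by have := size_tuple w; rewrite Dw.
  have szp : size p == j by have /eqP := size_tuple w; rewrite Dw size_rcons.
  by exists (Tuple szp, d); apply: val_inj.
have cardF : #|F| <= 4 * #|E|.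
  apply: leq_trans (leq_imset_card _ _) _.
  by rewrite mulnC cardsX cardsT card_ord.
suff leE' : #|E' :\: F| <= 3.
  rewrite expnS; have := subset_leq_card (subsetIr E' F); have := cardsID F E'; lia.
have [->|[w0]] := set_0Vmem (E' :\: F); first by rewrite cards0.
(* An empty pixel of the region outside [F] has a parent that is not empty. As the pixel itself is
   empty, the obstacle is a square strictly inside the parent. *)
have orph (w : j.-tuple 'I_4) d : ch (w, d) \in E' :\: F ->
    [/\ emptyb c (rcons w d), rg (rcons w d), rg w & exists2 r,
      r \in domf c & prefix w r /\ j < size r].
  rewrite !inE /= => /andP[NF /andP[cw rgw]].
  have rg_w : rg w by apply: rg_up cw rgw _; rewrite size_tuple leq_addr.
  have Ncw : ~~ emptyb c w.
    apply: contra NF => cw'; apply/imsetP; exists (w, d) => //.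
    by rewrite !inE cw' rg_w.
  split=> //; move/allPn: Ncw => [r rc /negPn wr]; exists r => //.
  have Nrwd : ~~ prefix r (rcons w d).
    by have /negbT := emptyb_nested cw rc; rewrite /nested => /norP[].
  have Nrw : ~~ prefix r w.
    by apply: contra Nrwd => /prefix_trans; apply; apply: prefix_rcons.
  have wr' : prefix w r by case/orP: wr => //; rewrite (negbTE Nrw).
  split=> //; rewrite ltnNge; apply: contra Nrw => ler.
  rewrite (prefix_size_eq wr') ?prefix_refl //; by rewrite size_tuple.
have [[w d] ->] := chP w0 => /[dup] w0E /orph[cwd rgwd rgw [r rc [wr ltjr]]].
(* Of two distinct parents, the earlier has an empty child and the later contains a square. Padding
   the child's path with quadrant 0 down to the layer of that square gives a pair that [inv]
   excludes. *)
have one_parent (v : j.-tuple 'I_4) e : ch (v, e) \in E' :\: F -> v = w.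
  have key (v1 v2 : j.-tuple 'I_4) e1 e2 : ch (v1, e1) \in E' :\: F ->
      ch (v2, e2) \in E' :\: F -> zltb v1 v2 = false.
    move=> /orph[c1 rg1 _ _] /orph[_ _ rg2 [r2 r2c [v2r ltr2]]].
    apply/negP => lt12.
    have szx : size (rcons v1 e1) <= size r2 by rewrite size_rcons size_tuple.
    pose x := rcons v1 e1 ++ nseq (size r2 - size (rcons v1 e1)) ord0.
    have px : prefix (rcons v1 e1) x by apply: prefix_prefix.
    apply: (inv x r2 v2) => //; first exact: emptyb_prefix c1.
    - exact: rg_down rg1.
    - by rewrite size_cat size_nseq subnKC.
    - apply: zltb_prefixr v2r _; apply: zltb_prefixl lt12.
      exact: prefix_trans (prefix_rcons _ _) px.
  move=> vE; apply: val_inj; apply: nested_size_inj; first by rewrite !size_tuple.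
  by rewrite nestedE (key _ _ _ _ vE w0E) (key _ _ _ _ w0E vE).
(* The square inside [w] lies in some child of [w], which is then not empty; at most three children
   are left. *)
have [e er] : exists e, prefix (rcons w e) r.
  case/prefixP: wr ltjr => -[|e s] ->; first by rewrite cats0 size_tuple ltnn.
  by exists e; rewrite -cat_rcons prefix_prefix.
apply: (@leq_trans #|[set ch (w, d') | d' in [set~ e]]|).
  apply/subset_leq_card/subsetP => w1; have [[v e1] ->] := chP w1.
  move=> /[dup] /one_parent-> /orph[cv _ _ _]; apply: imset_f.
  rewrite !inE; apply/eqP => e1e; have := emptyb_nested cv rc.
  by rewrite e1e /nested er.
by apply: leq_trans (leq_imset_card _ _) _; rewrite cardsC1 card_ord.
Qed.

End Configurations.

(** * Placing, removing and moving squares *)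

Section Updates.
Variables (R : realFieldType) (ID : choiceType) (side : ID -> R).
Implicit Types (c : config ID) (p q b : pixel) (B x : ID).

Lemma config_antichain c : is_configuration side c -> antichain c.
Proof. by case=> _ _ ac p q; apply: ac. Qed.

Definition mass c : R := (\sum_(p <- domf c) 4 ^- size p)%R.

Lemma mem_fnd c p x : (c.[? p]%fmap = Some x) -> p \in domf c.
Proof. by move=> cp; rewrite -fndSome cp. Qed.

Lemma emptyb_set c p q x : emptyb c.[p <- x]%fmap q = emptyb c q && ~~ nested q p.
Proof.
apply/allP/andP => [all_c|[/allP all_c Nqp] r].
  split; first by apply/allP => r rc; apply: all_c; rewrite mem_setf inE /= rc orbT.
  by apply: all_c; rewrite mem_setf inE /= eqxx.
by rewrite mem_setf inE => /predU1P[->|/all_c].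
Qed.

Lemma emptyb_rem c p q : emptyb c.[~ p]%fmap q -> ~~ nested q p -> emptyb c q.
Proof.
move=> /allP all_c Nqp; apply/allP => r rc; have [->//|rp] := eqVneq r p.
by apply: all_c; rewrite mem_remf1 rp.
Qed.

Lemma emptyb_remW c p q : emptyb c q -> emptyb c.[~ p]%fmap q.
Proof.
move=> /allP all_c; apply/allP => r; rewrite mem_remf1 => /andP[_]; exact: all_c.
Qed.

Lemma emptyb_rem_self c p : antichain c -> p \in domf c -> emptyb c.[~ p]%fmap p.
Proof.
move=> ac pc; apply/allP => r; rewrite mem_remf1 => /andP[rp rc].
by apply: contra rp => /orP[]/ac->.
Qed.

Lemma rem_configuration c p : is_configuration side c -> is_configuration side c.[~ p]%fmap.
Proof.
case=> sq inj ac; split=> [q x|q r x|q r]; rewrite ?fnd_rem1.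
- by case: ifP => // _; apply: sq.
- by do 2!case: ifP => // _; apply: inj.
by rewrite /occupied !mem_remf1 => /andP[_ qc] /andP[_ rc]; apply: ac.
Qed.

Lemma set_configuration c p x : is_configuration side c -> emptyb c p ->
  is_square side (layer p) x -> (forall q, c.[? q]%fmap <> Some x) ->
  is_configuration side c.[p <- x]%fmap.
Proof.
case=> sq inj ac ep sqx Nx; split=> [q y|q r y|q r]; rewrite ?fnd_set.
- by case: eqP => [->[<-]//|_]; apply: sq.
- case: eqP => [->|_]; case: eqP => [->|_] //; last exact: inj.
    by case=> <- /Nx.
  by move=> + [xy]; rewrite -xy => /Nx.
rewrite /occupied !mem_setf !inE => /predU1P[->|qc] /predU1P[->|rc] // pr.
- by have := emptyb_nested ep rc; rewrite /nested pr.
- by have := emptyb_nested ep qc; rewrite /nested pr orbT.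
exact: ac.
Qed.

Lemma mass_set c p x : p \notin domf c -> (mass c.[p <- x]%fmap = 4 ^- size p + mass c)%R.
Proof. by move=> pc; rewrite /mass dom_setf big_fsetU1. Qed.

Lemma mass_rem c p : p \in domf c -> (mass c = 4 ^- size p + mass c.[~ p]%fmap)%R.
Proof. by move=> pc; rewrite /mass domf_rem (big_fsetD1 p). Qed.

Definition content c x : Prop := exists p, c.[? p]%fmap = Some x.

Section Move.
Variables (c : config ID) (q b : pixel) (B : ID).
Hypotheses (c_conf : is_configuration side c) (cb : c.[? b]%fmap = Some B).
Hypotheses (cq : emptyb c q) (qb : size q = size b).
Let c' := c.[q <- B].[~ b]%fmap.

Lemma move_neq : q != b.
Proof. by apply: contraNneq (emptyb_notin cq) => ->; rewrite (mem_fnd cb). Qed.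

(** [q] and [b] differ, so the order of the two updates is immaterial. With the removal first, a
    move becomes the insertion of an absent square. *)
Lemma moveE : c' = c.[~ b].[q <- B]%fmap.
Proof. by rewrite /c' remf1_set eq_sym (negbTE move_neq). Qed.

Lemma mem_move r : (r \in domf c') = (r != b) && ((r == q) || (r \in domf c)).
Proof. by rewrite mem_remf1 mem_setf inE. Qed.

Lemma fnd_move r : (c'.[? r] = if r == b then None else if r == q then Some B else c.[? r])%fmap.
Proof. by rewrite fnd_rem1 fnd_set; case: eqP. Qed.

Lemma move_configuration : is_configuration side c'.
Proof.
rewrite moveE; apply: set_configuration.
- exact: rem_configuration.
- exact: emptyb_remW.
- by rewrite /layer qb; case: c_conf => sq _ _; apply: sq.
move=> r; rewrite fnd_rem1; case: eqVneq => //= rb crB.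
by case: c_conf => _ inj _; move: rb; rewrite (inj _ _ _ crB cb) eqxx.
Qed.

Lemma mass_move : mass c' = mass c.
Proof.
rewrite moveE mass_set; last exact/emptyb_notin/emptyb_remW.
by rewrite (mass_rem (mem_fnd cb)) qb.
Qed.

Lemma content_move x : content c' x <-> content c x.
Proof.
split=> [[r]|[r]]; rewrite /content.
  rewrite fnd_move; case: eqP => // _; case: eqP => [_ [<-]|_]; first by exists b.
  by exists r.
have [->|rb] := eqVneq r b; first rewrite cb => -[<-].
  by exists q; rewrite fnd_move (negbTE move_neq) eqxx.
move=> cr; exists r; rewrite fnd_move (negbTE rb); case: eqP => // rq.
by move: cq => /emptyb_notin; rewrite -rq (mem_fnd cr).
Qed.

Lemma emptyb_move_old r : emptyb c' r -> ~~ nested r b -> emptyb c r.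
Proof. by rewrite moveE emptyb_set => /andP[/emptyb_rem cr _] /cr. Qed.

Lemma emptyb_move_nested r : emptyb c' r -> ~~ nested r q.
Proof. by rewrite moveE emptyb_set => /andP[_]. Qed.

Lemma emptyb_move_self : emptyb c' b.
Proof.
have ac := config_antichain c_conf; have bc := mem_fnd cb.
rewrite moveE emptyb_set emptyb_rem_self //= nestedC.
by rewrite (emptyb_nested cq bc).
Qed.

Lemma zrank_move : zltb q b ->
  \sum_(p <- domf c') zrank p < \sum_(p <- domf c) zrank p.
Proof.
move=> lt_qb; have Nq : q \notin domf c.[~ b]%fmap by apply/emptyb_notin/emptyb_remW.
rewrite moveE dom_setf (big_fsetU1 _ _ Nq) domf_rem.
by rewrite [ltnRHS](big_fsetD1 b (mem_fnd cb)) ltn_add2r zrank_mono.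
Qed.

End Move.
End Updates.

(** * Invariants of the deletion procedure *)

Section Deletion.
Variables (R : realFieldType) (ID : choiceType) (side : ID -> R).
(** [D] bounds the layers of all squares, [Q] singles out the squares left after the removal, and
    [mu] is their total volume. All three stay fixed during a deletion. *)
Variables (D : nat) (Q : ID -> Prop) (mu : R).
Implicit Types (c : config ID) (a b p q x y : pixel) (S : {fset pixel}).
Implicit Types (ob : option pixel).

Definition violation c p q : bool :=
  [&& emptyb c p, q \in domf c, size p == size q & zltb p q].

(** This makes [free_count_lt] applicable inside [a]. It holds in the first run of the inner loop,
    which starts with an empty [a]. *)
Definition tidy c a : Prop :=
  forall p q, violation c p q -> prefix a p -> prefix a q -> False.

Definition dead c y : Prop :=
  forall q, q \in domf c -> zltb y q -> size q < size y.

(** The pixels that the inner loop has yet to consider, [ob] being the next one. *)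
Definition up_to ob q : bool :=
  if ob is Some b then (q == b) || zltb q b else false.

(* Areas are counted in pixels of layer D, so 4 ^ (D - size q) is the area of q. *)
Definition few_before c q : bool :=
  free_count D c (zltb^~ q) < 2 * 4 ^ (D - size q).

Definition few_outside c a q : bool :=
  free_count D c (fun w => zltb w q && ~~ prefix a w) < 4 ^ (D - size q).

(** [p] is a gap that the run for [s] can fill, and [q] is late enough to be considered in that
    run. *)
Definition covered c S p q : Prop :=
  exists s, [/\ s \in S, prefix s p & zltb s q].

Definition nested_dead c S : Prop :=
  forall x y, x \in S -> y \in S -> prefix x y -> x != y -> dead c y.

(** A pixel of [S] inside [a] may receive a square packed into [a] and is then no longer empty. Such
    stale pixels are harmless if every [y] before the square is dead. *)
Definition stale_dead c S S' : Prop :=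
  forall x q y, x \in S -> q \in domf c -> prefix x q -> y \in S' -> zltb y q -> dead c y.

Record sound c : Prop := Sound {
  sound_config : is_configuration side c;
  sound_depth : forall p, p \in domf c -> size p <= D;
  sound_content : forall u, content c u <-> Q u;
  sound_mass : mass R c = mu }.

(* The second alternative of outer_few and inner_few concerns the first run of
   the inner loop, for the squares that it has not yet considered. *)
Record outer_inv c S : Prop := OuterInv {
  outer_sound : sound c;
  outer_covered : forall p q, violation c p q -> covered c S p q;
  outer_nested : nested_dead c S;
  outer_stale : stale_dead c S S;
  outer_few : forall q, q \in domf c -> few_before c q \/
    exists a, [/\ S = [fset a]%fset, emptyb c a, zltb a q & few_outside c a q] }.

Record inner_inv c S a ob : Prop := InnerInv {
  inner_sound : sound c;
  inner_occ : forall b, ob = Some b -> b \in domf c;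
  inner_first : forall s, s \in S -> ~~ zltb s a;
  inner_covered : forall p q, violation c p q ->
    covered c S p q \/ [/\ prefix a p, zltb a q & up_to ob q];
  inner_nested : nested_dead c (a |` S)%fset;
  inner_stale : stale_dead c S (a |` S)%fset;
  inner_few : forall q, q \in domf c -> few_before c q \/
    [/\ tidy c a, zltb a q, up_to ob q & few_outside c a q] }.

Lemma sound_antichain c : sound c -> antichain c.
Proof. by case=> /config_antichain. Qed.

(** Occupied pixels are totally ordered, so one that is not after the last is the last or precedes
    it. *)
Lemma z_last_up_to c (P : pixel -> Prop) ob q : antichain c ->
  (forall p, P p -> p \in domf c) -> z_last_opt P ob -> P q -> up_to ob q.
Proof.
move=> ac Pc; case: ob => [b [Pb bmax]|Pnone] Pq /=; last by case: (Pnone q).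
have /negPf Nbq : ~~ zltb b q by apply/negP => /zltP; apply: bmax.
by have := antichain_zltb ac (Pc _ Pq) (Pc _ Pb); rewrite Nbq orbF.
Qed.

(** For [a] no smaller than [q], apply [free_count_lt] to the part of [a] before [q]. A smaller [a]
    has less area than [q] even if all of it is free. *)
Lemma tidy_free_count c a q : tidy c a -> q \in domf c -> size q <= D ->
  zltb a q || prefix a q ->
  (forall p, size p = size q -> prefix a p -> zltb p q -> ~~ emptyb c p) ->
  free_count D c (fun w => prefix a w && zltb w q) < 4 ^ (D - size q).
Proof.
move=> tidya qc qD aq full; case: (leqP (size a) (size q)) => [le_aq|lt_qa].
  apply: free_count_lt => // [x y xy /andP[ax xq]|p d cp /andP[apd pdq] le_qp||].
  - by rewrite (prefix_trans ax xy) (zltb_prefixl xy xq).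
  - have Npd : a != rcons p d.
      by apply/eqP => aE; move: le_aq; rewrite aE size_rcons; lia.
    rewrite (prefix_rconsr apd Npd) /=.
    have /orP[//|pq] := zltb_ancestorl (prefix_rcons p d) pdq.
    have := emptyb_nested cp qc.
    by rewrite -(prefix_size_eq pq le_qp) /nested prefix_rcons orbT.
  - move=> p r x cp /andP[ap pq] rc sz pr xr /andP[ax _].
    apply: (tidya p r) => //; last exact: prefix_trans ax xr.
    by rewrite /violation cp rc sz eqxx.
  by move=> p szp /andP[ap pq]; apply: full.
apply: leq_ltn_trans (_ : #|[set w : D.-tuple 'I_4 | prefix a w]| < _).
  by apply/subset_leq_card/subsetP => w; rewrite !inE => /and3P[].
have [aD|Da] := leqP (size a) D; first by rewrite card_tuple_prefix // ltn_exp2l //; lia.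
rewrite (_ : [set w | _] = set0) ?cards0 ?expn_gt0 //; apply/setP => w; rewrite !inE.
by apply/negP => /size_prefix; rewrite size_tuple leqNgt Da.
Qed.

(** Less than the area of [q] is free inside [a], where [q] does not fit, and less than that area is
    free outside [a]. *)
Lemma tidy_skip_few c a q : tidy c a -> q \in domf c -> size q <= D -> zltb a q ->
  few_outside c a q ->
  (forall p, size p = size q -> prefix a p -> ~~ emptyb c p) -> few_before c q.
Proof.
move=> tidya qc qD aq few full; have := @free_count_split ID D c (zltb^~ q) (prefix a).
have := tidy_free_count tidya qc qD; rewrite aq => /(_ isT).
move: few; rewrite /few_outside /few_before => few H.
by have := H (fun p sp ap _ => full p sp ap); lia.
Qed.

Lemma outer_step c S a ob : outer_inv c S ->
  z_first (fun s => s \in S) a -> z_last_opt (occupied c) ob ->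
  inner_inv c (S `\ a)%fset a ob.
Proof.
case=> snd cov nest stale few [aS amin] blast.
have ac := sound_antichain snd.
have up q : q \in domf c -> up_to ob q by move=> qc; apply: z_last_up_to ac _ blast qc.
split=> //.
- by move=> b obE; move: blast; rewrite obE; case.
- move=> s; rewrite !inE => /andP[_ sS]; apply/negP => /zltP; exact: amin.
- move=> p q /[dup] v /cov[s [sS sp sq]]; have /and4P[_ qc _ _] := v.
  have [sa|sa] := eqVneq s a; first by right; rewrite -sa; split=> //; apply: up.
  by left; exists s; rewrite !inE sa.
- by rewrite fsetD1K.
- by rewrite fsetD1K // => x q y; rewrite !inE => /andP[_ xS]; apply: stale.
move=> q qc; have [|[a0 [SE ca a0q fewq]]] := few q qc; first by left.
move: aS; rewrite SE inE => /eqP->; right; split=> //; last exact: up.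
(* An empty [a] contains no occupied pixel and is therefore tidy. *)
by move=> p r /and4P[_ rc _ _] _ ar; have := emptyb_nested ca rc; rewrite /nested ar.
Qed.

(** At the exit no unconsidered square comes after [a], so the alternatives that mention [a] are
    void. *)
Lemma exit_step c S a ob : inner_inv c S a ob ->
  (forall b, ob = Some b -> ~ zlt a b) -> outer_inv c S.
Proof.
case=> snd _ _ cov nest stale few ex.
have stop q : zltb a q -> up_to ob q -> False.
  case: ob ex {cov few} => //= b ex aq qb; apply: (ex b) => //; apply/zltP.
  by case/predU1P: qb aq => [->//|qb] /zltb_trans; apply.
split=> // [p q /cov[//|[_ aq /(stop _ aq)//]]|x y xS yS|x q y xS qc xq yS|q /few[|[_ aq /(stop _ aq)//]]].
- by apply: nest; rewrite !inE ?xS ?yS orbT.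
- by apply: stale xq _ => //; rewrite !inE yS orbT.
by left.
Qed.

(** Only [b] leaves the unconsidered squares. It has no violation with a pixel inside [a], where its
    layer is full, and [tidy_skip_few] bounds the area before it. *)
Lemma skip_step c S a b ob : inner_inv c S a (Some b) -> zlt a b ->
  (forall q, ~ packing_place c a (layer b) q) ->
  z_last_opt (fun p => occupied c p /\ zlt p b) ob -> inner_inv c S a ob.
Proof.
case=> snd occ fst cov nest stale few ab full blast.
have ac := sound_antichain snd; have bc := occ b erefl.
have up q : q \in domf c -> zltb q b -> up_to ob q.
  move=> qc /zltP qb; apply: z_last_up_to ac _ blast _ => //; by move=> p [].
have full' p : size p = size b -> prefix a p -> ~~ emptyb c p.
  by move=> szp ap; apply/negP => /emptybP cp; apply: (full p).
split=> //.
- by move=> d obE; move: blast; rewrite obE => -[[]].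
- move=> p q /[dup] /and4P[cp qc /eqP sz _] /cov[|[ap aq /predU1P[qb|qb]]]; first by left.
    by have := full' p; rewrite -qb cp sz => /(_ erefl ap).
  by right; split=> //; apply: up.
move=> q qc; have [|[tidya aq /predU1P[qb|qb] fewq]] := few q qc; first by left.
  left; rewrite qb in fewq aq *; apply: tidy_skip_few fewq full' => //.
  exact: sound_depth snd _ bc.
by right; split=> //; apply: up.
Qed.

(** * Preservation of the invariant by one packing *)

Section Pack.
Variables (c : config ID) (S : {fset pixel}) (a b : pixel) (B : ID) (q b' : pixel).
Variable ob : option pixel.
Let c' := c.[q <- B].[~ b]%fmap.
Hypotheses (inv : inner_inv c S a (Some b)) (ab : zltb a b).
Hypothesis cb : c.[? b]%fmap = Some B.
Hypothesis qfirst : z_first (packing_place c a (layer b)) q.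
Hypotheses (maxb' : maximally_empty c' b') (b'b : prefix b' b).
Hypothesis blast : z_last_opt (fun p => occupied c' p /\ zlt p b) ob.

Let snd : sound c := inner_sound inv.
Let c_conf : is_configuration side c := sound_config snd.
Let ac : antichain c := sound_antichain snd.
Let bc : b \in domf c := mem_fnd cb.
Let aq : prefix a q. Proof. by case: qfirst => -[]. Qed.
Let qb : size q = size b. Proof. by case: qfirst => -[]. Qed.
Let cq : emptyb c q. Proof. by apply/emptybP; case: qfirst => -[]. Qed.
Let lt_qb : zltb q b := zltb_prefixl aq ab.
Let b'E : emptyb c' b'. Proof. by apply/emptybP; case: maxb'. Qed.

Let dom' r : (r \in domf c') = (r != b) && ((r == q) || (r \in domf c)).
Proof. exact: mem_move. Qed.

Let old r : emptyb c' r -> ~~ nested r b -> emptyb c r.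
Proof. exact: emptyb_move_old. Qed.

Let not_first p : emptyb c p -> size p = size q -> prefix a p -> zltb p q = false.
Proof.
move=> cp sz ap; apply/negP => /zltP; case: qfirst => _; apply; split=> //.
  by rewrite /layer sz qb.
exact/emptybP.
Qed.

(** The pixel [q] inside [a] has the layer of [b], a square after [a]. This refutes every case below
    in which [a] would be dead. *)
Let a_alive : ~ dead c a.
Proof. by move/(_ b bc ab); rewrite -qb ltnNge size_prefix. Qed.

(** A [b'] containing [a] would contain [q], which is occupied after the move, although [b'] is
    empty. *)
Let lt_ab' : zltb a b'.
Proof.
have /orP[//|b'a] := zltb_ancestorr b'b ab.
have /negP := emptyb_move_nested cb cq b'E.
by case; rewrite /nested (prefix_trans b'a aq).
Qed.

Let after_b' r : r \in domf c' -> zltb b' r -> [/\ r \in domf c, r != b & zltb b r].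
Proof.
move=> rc' /(zltb_prefixl b'b) br; move: rc'; rewrite dom' => /andP[rb].
by case/predU1P=> [rq|//]; move: lt_qb; rewrite -rq (zltb_asym br).
Qed.

(** Only the removal from [b] empties pixels, and what it empties lies inside [b']. A square after
    [p] cannot be inside the empty [b'], so it comes after [b']. *)
Let freed p r : emptyb c' p -> ~~ emptyb c p -> zltb p r -> r \in domf c' ->
  prefix b' p && zltb b' r.
Proof.
move=> c'p Ncp pr rc'.
have pb : nested p b by apply: contraNT Ncp; apply: old.
have b'p := maximally_empty_prefix maxb' b'b c'p pb; rewrite b'p /=.
have /orP[//|b'r] := zltb_ancestorl b'p pr.
by have := emptyb_nested b'E rc'; rewrite /nested b'r.
Qed.

Lemma pack_sound : sound c'.
Proof.
split.
- exact: move_configuration.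
- move=> p; rewrite dom' => /andP[_ /predU1P[->|]]; last exact: sound_depth snd p.
  by rewrite qb; apply: sound_depth snd b bc.
- by move=> x; rewrite content_move //; apply: sound_content snd x.
by rewrite mass_move //; apply: sound_mass snd.
Qed.

(** The moved square keeps its layer, and whatever precedes [q] also precedes [b]. *)
Lemma pack_dead y : dead c y -> dead c' y.
Proof.
move=> dy r; rewrite dom' => /andP[_ /predU1P[->|rc yr]]; last exact: dy.
rewrite qb => yq; apply: dy => //.
by have /orP[/zltb_trans|/zltb_prefixl] := zltb_ancestorr aq yq; apply.
Qed.

(** If [r] precedes [b], nothing before [r] is freed. Otherwise [q] and [b] both precede [r], and
    the area gained at [b] equals the area lost at [q]. *)
Lemma pack_free_count r : r \in domf c -> r != b ->
  free_count D c' (zltb^~ r) <= free_count D c (zltb^~ r).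
Proof.
move=> rc rb; have := antichain_zltb ac rc bc; rewrite (negbTE rb) /=.
case/orP=> [lt_rb|lt_br].
  apply: free_count_le => w c'w wr; rewrite wr old //.
  by rewrite (zltb_not_nested (zltb_trans wr lt_rb)).
have bD := sound_depth snd bc.
have cardb := card_tuple_prefix bD; rewrite -qb in bD cardb.
have := card_tuple_prefix bD; rewrite -{}cardb /free_count.
set Cq := [set w : D.-tuple 'I_4 | prefix q w]; set Cb := [set w : D.-tuple 'I_4 | prefix b w].
set X' := [set w | _]; set X := [set w | _] => cardC.
have CqX : Cq \subset X.
  apply/subsetP => w; rewrite !inE => qw; rewrite (emptyb_prefix qw cq) /=.
  exact: zltb_prefixl qw (zltb_trans lt_qb lt_br).
rewrite -(cardsID Cq X) (setIidPr CqX) cardC addnC.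
apply: leq_trans (leq_card_setU _ _); apply/subset_leq_card/subsetP => w.
rewrite !inE => /andP[c'w wr]; rewrite wr andbT.
have /norP[_ ->] := emptyb_move_nested cb cq c'w.
have [bw|Nbw] := boolP (prefix b w); rewrite ?orbT //= orbF.
apply: old => //; rewrite /nested (negbTE Nbw) orbF.
apply: contra Nbw => wb; rewrite (prefix_size_eq wb) ?prefix_refl //.
by rewrite size_tuple -qb.
Qed.

Lemma pack_few_outside r : r \in domf c -> zltb r b ->
  few_outside c a r -> few_outside c' a r.
Proof.
move=> rc rb; apply: leq_ltn_trans; apply: free_count_le => w c'w /andP[wr ->].
by rewrite wr old // (zltb_not_nested (zltb_trans wr rb)).
Qed.

(** Pixels inside [a] are not emptied by the move, and no empty pixel of the layer inside [a]
    precedes [q], the first choice. *)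
Lemma pack_tidy : tidy c a -> tidy c' a.
Proof.
move=> tidya p r /and4P[c'p rc' /eqP sz pr] ap ar.
have cp : emptyb c p by apply: old => //; rewrite (zltb_not_nested (zltb_prefixl ap ab)).
move: rc'; rewrite dom' => /andP[_ /predU1P[rq|rc]].
  by move: pr; rewrite rq not_first // sz rq.
by apply: (tidya p r); rewrite // /violation cp rc sz eqxx.
Qed.

Lemma pack_few r : r \in domf c' ->
  few_before c' r \/ [/\ tidy c' a, zltb a r, up_to ob r & few_outside c' a r].
Proof.
move=> /[dup] rc'; rewrite dom' => /andP[rb /predU1P[->|rc]].
  (* The moved square inherits the bound of [b], since the area before [q] is part of the area
     before [b]. In the first run, less than one square is free inside [a] before [q], again because
     [q] is the first choice. *)
  left; have [few|[tidya _ _ few]] := inner_few inv bc.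
    rewrite /few_before qb; apply: leq_ltn_trans few; apply: free_count_le => w c'w wq.
    by rewrite (zltb_trans wq lt_qb) old // (zltb_not_nested (zltb_trans wq lt_qb)).
  have qD : size q <= D by rewrite qb; apply: sound_depth snd _ bc.
  have qc' : q \in domf c' by rewrite dom' eqxx (move_neq cb cq).
  have lt1 : free_count D c' (fun w => prefix a w && zltb w q) < 4 ^ (D - size q).
    apply: tidy_free_count (pack_tidy tidya) qc' qD _ _; first by rewrite aq orbT.
    move=> p sz ap pq; apply/negP => c'p; move: (pq).
    by rewrite not_first // old // (zltb_not_nested (zltb_prefixl ap ab)).
  have lt2 : few_outside c' a q.
    rewrite /few_outside qb; apply: leq_ltn_trans few.
    apply: free_count_le => w c'w /andP[wq ->].
    by rewrite (zltb_trans wq lt_qb) old // (zltb_not_nested (zltb_trans wq lt_qb)).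
  have := @free_count_split ID D c' (zltb^~ q) (prefix a).
  by move: lt1 lt2; rewrite /few_outside /few_before; lia.
have [few|[tidya ar /predU1P[rb'|lt_rb] few]] := inner_few inv rc.
- by left; apply: leq_ltn_trans (pack_free_count rc rb) few.
- by rewrite rb' eqxx in rb.
right; split=> //; [exact: pack_tidy | | exact: pack_few_outside].
apply: (z_last_up_to (sound_antichain pack_sound) _ blast); first by move=> p [].
by split=> //; apply/zltP.
Qed.

(* A square after b' has free area for fewer than two of its kind before it;
   this includes b', which is therefore no larger than the square. *)
Lemma pack_dead_inside y : prefix b' y -> b' != y -> dead c' y.
Proof.
move=> b'y Nb'y r rc' yr; have [rc rb lt_br] : [/\ r \in domf c, r != b & zltb b r].
  apply: after_b' => //; have /orP[//|b'r] := zltb_ancestorl b'y yr.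
  by have := emptyb_nested b'E rc'; rewrite /nested b'r.
have lt_b'r : zltb b' r.
  have /orP[//|b'r] := zltb_ancestorl b'b lt_br.
  by have := emptyb_nested b'E rc'; rewrite /nested b'r.
have few : few_before c' r.
  have [few|[_ _ /predU1P[rE|/zltb_asym]]] := inner_few inv rc.
  - exact: leq_ltn_trans (pack_free_count rc rb) few.
  - by rewrite rE eqxx in rb.
  by rewrite lt_br.
rewrite ltnNge; apply/negP => le_yr.
have lt_b'y : size b' < size y.
  rewrite ltnNge; apply: contra Nb'y => le; exact/eqP/prefix_size_eq.
have lt_b'r' := leq_trans lt_b'y le_yr.
have rD : size r <= D by apply: sound_depth snd _ rc.
have b'D : size b' <= D by apply: leq_trans (ltnW lt_b'r') rD.
have := few; rewrite /few_before ltnNge => /negP; apply.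
apply: (@leq_trans (4 ^ (D - size b'))).
  apply: (@leq_trans (4 ^ (D - size r).+1)); first by rewrite expnS leq_mul2r orbT.
  by rewrite leq_exp2l // ltn_sub2l // (leq_trans lt_b'r').
rewrite -(card_tuple_prefix b'D).
apply/subset_leq_card/subsetP => w; rewrite !inE => b'w.
by rewrite (emptyb_prefix b'w b'E) (zltb_prefixl b'w lt_b'r).
Qed.

Lemma pack_step : inner_inv c' ((b' |` S) `\` children b')%fset a ob.
Proof.
have sub x : x \in ((b' |` S) `\` children b')%fset -> x = b' \/ x \in S.
  by rewrite !inE => /andP[_ /predU1P].
split.
- exact: pack_sound.
- by move=> d obE; move: blast; rewrite obE => -[[]].
- by move=> s /sub[->|/(inner_first inv)//]; rewrite (zltb_asym lt_ab').
- have b'S : b' \in ((b' |` S) `\` children b')%fset.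
    rewrite !inE eqxx andbT; apply/imfsetP => -[d _ /(congr1 size)].
    by rewrite size_rcons; lia.
  (* Where a child of [b'] is dropped from the set, [b'] itself takes over its violations. *)
  have keep s p r : s \in S -> prefix s p -> zltb s r -> emptyb c' p -> r \in domf c' ->
      zltb p r -> covered c' ((b' |` S) `\` children b')%fset p r.
    move=> sS sp sr c'p rc' pr; have [sch|Nsch] := boolP (s \in children b').
      exists b'; split=> //; case/imfsetP: sch sp sr => d _ -> /= sp sr.
        exact: prefix_trans (prefix_rcons _ _) sp.
      have /orP[//|b'r] := zltb_ancestorl (prefix_rcons _ _) sr.
      by have := emptyb_nested b'E rc'; rewrite /nested b'r.
    by exists s; split=> //; rewrite in_fsetD Nsch !inE sS orbT.
  move=> p r /and4P[c'p rc' /eqP sz pr].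
  have [cp|/freed] := boolP (emptyb c p); last first.
    by move=> /(_ r c'p pr rc')/andP[b'p b'r]; left; exists b'.
  have := rc'; rewrite dom' => /andP[rb /predU1P[rq|rc]]; last first.
    have v : violation c p r by rewrite /violation cp rc sz eqxx.
    have [[s [sS sp sr]]|[ap ar /predU1P[rb'|lt_rb]]] := inner_covered inv v.
    - by left; apply: keep sS sp sr _ _ _.
    - by rewrite rb' eqxx in rb.
    right; split=> //; apply: (z_last_up_to (sound_antichain pack_sound) _ blast).
      by move=> ? [].
    by split=> //; apply/zltP.
  (* A violation with the moved square: [p] is outside [a], so [(p, b)] was a violation before,
     covered by some [s]. If [s] does not precede [q], it contains [q] and lies strictly above [a],
     and [a] would be dead. *)
  rewrite rq in sz pr rc' *.
  have Nap : ~~ prefix a p by apply: contraL pr => /(not_first cp sz)->.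
  have pb := zltb_trans pr lt_qb.
  have v : violation c p b by rewrite /violation cp bc sz qb eqxx.
  have [[s [sS sp sb]]|[ap]] := inner_covered inv v; last by rewrite ap in Nap.
  have /orP[sq|sq] := zltb_ancestorl sp pr; first by left; apply: keep sS sp sq _ _ _.
  case: a_alive; have /orP[sa|as_] := prefix_total sq aq.
    apply: (inner_nested inv (x := s)); rewrite ?inE ?eqxx ?sS ?orbT //.
    by apply: contraNneq Nap => <-.
  by rewrite (prefix_trans as_ sp) in Nap.
(* An [x] of [S] strictly above [b'] would have contained the square at [b], and staleness would
   make [a] dead. Pixels strictly inside [b'] are dead by [pack_dead_inside]. *)
- move=> x y; rewrite !in_fset1U => xS yS xy Nxy.
  have [yb'|Nyb'] := eqVneq y b'.
    rewrite yb' in xy Nxy *; case: a_alive.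
    have xS' : x \in S.
      case/predU1P: xS => [xa|/sub[xb'|//]]; last by rewrite xb' eqxx in Nxy.
      by move: lt_ab' xy; rewrite xa => /zltb_not_nested/negbT/norP[/negbTE->].
    apply: (inner_stale inv xS' bc (prefix_trans xy b'b)) => //.
    by rewrite !inE eqxx.
  have [xb'|Nxb'] := eqVneq x b'; first by rewrite xb' in xy Nxy; apply: pack_dead_inside.
  have mem z : z != b' -> (z == a) || (z \in ((b' |` S) `\` children b')%fset) ->
      z \in (a |` S)%fset.
    move=> Nz /predU1P[->|/sub[zb'|zS]]; rewrite !inE ?eqxx ?zS ?orbT //.
    by rewrite zb' eqxx in Nz.
  exact/pack_dead/(inner_nested inv (mem x Nxb' xS) (mem y Nyb' yS) xy Nxy).
- move=> x r y /sub[->|xS] rc' xr yS yr.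
    by have := emptyb_nested b'E rc'; rewrite /nested xr.
  have yS' : y = b' \/ y \in (a |` S)%fset.
    move: yS; rewrite in_fset1U => /predU1P[->|/sub[->|yS]]; rewrite ?inE ?eqxx; [by right|by left|].
    by right; rewrite yS orbT.
  have := rc'; rewrite dom' => /andP[rb /predU1P[rq|rc]]; last first.
    case: yS' => [yb'|yS']; last first.
      exact: pack_dead (inner_stale inv xS rc xr yS' yr).
    case: a_alive; apply: (inner_stale inv xS rc xr); first by rewrite !inE eqxx.
    by apply: zltb_trans lt_ab' _; rewrite -yb'.
  (* The square just packed makes [x] stale. A pixel [y] before it cannot precede [a], the first
     choice from the set, so it lies strictly inside [a] and was dead already. *)
  rewrite rq in xr yr.
  case: yS' => [yb'|yS'].
    by have := zltb_prefixl aq lt_ab'; rewrite -yb' => /zltb_asym; rewrite yr.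
  apply: pack_dead.
  have ay : prefix a y && (a != y).
    have Nay : a != y by apply: contraTneq yr => <-; apply/negP => /zltb_not_nested; rewrite /nested aq.
    rewrite Nay andbT; have /orP[ya|//] := zltb_ancestorr aq yr.
    move: yS'; rewrite in_fset1U eq_sym (negbTE Nay) /= => /(inner_first inv).
    by rewrite ya.
  by case/andP: ay => ay Nay; apply: (inner_nested inv _ yS' ay Nay); rewrite !inE eqxx.
exact: pack_few.
Qed.

End Pack.
End Deletion.

(** * Progress and termination of the deletion procedure *)

Lemma exists_z_last_opt (P : pixel -> Prop) (s : seq pixel) :
  (forall p, P p <-> p \in s) -> exists ob, z_last_opt P ob.
Proof.
move=> Ps; have [s0|] := eqVneq s [::].
  by exists None => q /Ps; rewrite s0.
have gt_irr : irreflexive (fun p q => zltb q p) by move=> p; apply: zltbxx.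
have gt_trans : transitive (fun p q => zltb q p) by move=> q p r pq /zltb_trans->.
case/(seq_extremum gt_irr gt_trans)=> b bs bmax; exists (Some b).
split; first exact/Ps.
by move=> q /Ps qs /zltP; apply/negP/bmax.
Qed.

Section Termination.
Variables (R : realFieldType) (ID : choiceType) (side : ID -> R).
Variables (D : nat) (Q : ID -> Prop) (mu : R).
Implicit Types (c : config ID) (st : state ID) (S : {fset pixel}).

Definition state_inv st : Prop :=
  match st with
  | Begin _ _ => False
  | Outer c T => outer_inv side D Q mu c T
  | Inner c T a ob => inner_inv side D Q mu c T a ob
  end.

Lemma step_state_inv st st' : state_inv st -> step st st' -> state_inv st'.
Proof.
move=> + stp; case: stp => //= {st st'}.
- by move=> c S a ob afst blast inv; apply: outer_step inv afst blast.
- move=> c c' S a b B q b' ob /zltP ab cb qfst -> maxb' b'b blast inv.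
  exact: (pack_step inv ab cb qfst maxb' b'b blast).
- by move=> c S a b ob ab full blast inv; apply: skip_step inv ab full blast.
by move=> c S a ob ex inv; apply: exit_step inv ex.
Qed.

(** The first component of a lexicographic measure. A packing lowers it, the choice of [a] lowers
    [pending], and a skip or an exit lowers [remaining]. *)
Definition weight st : nat :=
  match st with
  | Begin _ _ => 0
  | Outer c _ | Inner c _ _ _ => \sum_(p <- domf c) zrank p
  end.

Definition pending st : nat :=
  match st with
  | Begin _ _ => 0
  | Outer _ T | Inner _ T _ _ => #|` T|
  end.

(** The successor makes the exit of the inner loop a decrease even if no square remains. *)
Definition remaining st : nat :=
  match st with
  | Inner c _ _ ob => (#|` [fset p in domf c | up_to ob p]%fset|).+1
  | _ => 0
  end.

Lemma step_decreases st st' : state_inv st -> step st st' ->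
  weight st' < weight st \/ weight st' = weight st /\
  (pending st' < pending st \/ pending st' = pending st /\
   remaining st' < remaining st).
Proof.
move=> + stp; case: stp => //= {st st'}.
- move=> c S a ob [aS _] _ _; right; split=> //; left.
  by rewrite [ltnRHS](cardfsD1 a) aS.
- move=> c c' S a b B q b' ob /zltP ab cb [[aq qb /emptybP cq] _] -> _ _ _ inv.
  by left; apply: zrank_move => //; apply: zltb_prefixl ab.
- move=> c S a b ob ab _ blast inv; right; split=> //; right; split=> //.
  rewrite ltnS; apply: fproper_ltn_card; have bc := inner_occ inv erefl.
  rewrite fproperE; apply/andP; split; first apply/fsubsetP => p.
    rewrite !inE /= => /andP[-> /=]; case: ob blast => //= d [[_ /zltP db] _].
    by case/predU1P=> [->|/zltb_trans/(_ db)->]; rewrite ?db orbT.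
  apply/negP => /fsubsetP/(_ b); rewrite !inE /= bc eqxx => /(_ isT) /=.
  case: ob blast => //= d [[_ /zltP db] _]; rewrite (zltb_asym db) orbF => /eqP bd.
  by rewrite bd zltbxx in db.
by move=> c S a ob _ _; right; split=> //; right.
Qed.

Lemma state_progress st : state_inv st ->
  (exists c, st = Outer c fset0) \/ exists st', step st st'.
Proof.
case: st => //= [c S|c S a ob] inv.
  have [->|/fset0Pn[s0 s0S]] := eqVneq S fset0; first by left; exists c.
  have [|a aS amin] := @seq_extremum _ zltbxx zltb_trans (enum_fset S).
    by apply/eqP => S0; have : s0 \in enum_fset S := s0S; rewrite S0.
  have [ob blast] := @exists_z_last_opt (occupied c) (domf c) (fun p => iff_refl _).
  right; exists (Inner c (S `\ a)%fset a ob); apply: step_outer => //.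
  by split=> // s sS /zltP; apply/negP/amin.
right; case: ob inv => [b|] inv; last by exists (Outer c S); apply: step_exit.
have [ab|Nab] := boolP (zltb a b); last first.
  by exists (Outer c S); apply: step_exit => _ [<-] /zltP; apply/negP.
have bc := inner_occ inv erefl; have [B cb] : exists B, c.[? b]%fmap = Some B by exists c.[bc]%fmap; apply: in_fnd.
have c_conf := sound_config (inner_sound inv).
(* The layer of [b] is finite, so a search decides between packing and skipping. *)
have [/existsP[t /andP[aq cq]]|/existsPn full] :=
    boolP [exists t : (size b).-tuple 'I_4, prefix a t && emptyb c t]; last first.
  have [p|ob blast] := @exists_z_last_opt (fun p => occupied c p /\ zlt p b)
      [seq p <- domf c | zltb p b].
    by rewrite mem_filter andbC; split=> [[pc /zltP->]|/andP[pc /zltP]] //; rewrite andbT.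
  exists (Inner c S a ob); apply: step_skip => //; first exact/zltP.
  move=> q [aq /eqP qb /emptybP cq]; have := full (Tuple qb).
  by rewrite aq cq.
have [q [[qb /andP[aq' cq']] qmin]] : exists q,
    z_first (fun q => layer q = size b /\ prefix a q && emptyb c q) q.
  by apply: exists_z_first; exists t; rewrite ?size_tuple ?aq.
have c'b : emptyb c.[q <- B].[~ b]%fmap b by apply: emptyb_move_self c_conf cb cq'.
have [b' [maxb' b'b]] := maximally_emptyP c'b.
set c' := c.[q <- B].[~ b]%fmap in c'b maxb'.
have [p|ob blast] := @exists_z_last_opt (fun p => occupied c' p /\ zlt p b)
    [seq p <- domf c' | zltb p b].
  by rewrite mem_filter andbC; split=> [[pc /zltP->]|/andP[pc /zltP]] //; rewrite andbT.
exists (Inner c' ((b' |` S) `\` children b')%fset a ob).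
apply: (@step_pack _ c c' S a b B q b' ob) => //; first exact/zltP.
split=> [|r [ar rb /emptybP cr]]; first by split=> //; apply/emptybP.
by apply: qmin; rewrite ar cr.
Qed.

Lemma state_terminates st : state_inv st -> terminates st.
Proof.
have [m] := ubnP (weight st); elim: m st => // m IHm st.
have [n] := ubnP (pending st); elim: n st => // n IHn st.
have [k] := ubnP (remaining st); elim: k st => // k IHk st.
rewrite !ltnS => le_k le_n le_m inv.
have [[c ->]|prog] := state_progress inv; first exact: terminates_exit.
apply: terminates_step prog _ => st' stp; have inv' := step_state_inv inv stp.
have [lt_m|[eq_m [lt_n|[eq_n lt_k]]]] := step_decreases inv stp.
- by apply: IHm => //; apply: leq_trans lt_m le_m.
- by apply: IHn => //; rewrite ?eq_m //; apply: leq_trans lt_n le_n.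
by apply: IHk; rewrite ?eq_m ?eq_n //; apply: leq_trans lt_k le_k.
Qed.

Lemma run_state_inv st st' : state_inv st ->
  clos_refl_trans (state ID) (@step ID) st st' -> state_inv st'.
Proof.
move=> inv run; have {}run := clos_rt_rt1n _ _ _ _ run.
elim: run inv => // {}st st1 st2 stp _ IH inv.
by apply: IH; apply: step_state_inv inv stp.
Qed.

End Termination.

Lemma terminates_run (ID : choiceType) (st : state ID) : terminates st ->
  exists c, clos_refl_trans (state ID) (@step ID) st (Outer c fset0).
Proof.
elim=> {st} [c|st [st' stp] _ IH]; first by exists c; apply: rt_refl.
by have [c run] := IH st' stp; exists c; apply: rt_trans run; apply: rt_step.
Qed.

(** * Effect of a single request *)

Section Requests.
Variables (R : realFieldType) (ID : choiceType) (side : ID -> R).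
Hypothesis side_gt0 : forall x : ID, (0 < side x)%R.
Implicit Types (c : config ID) (s : seq (request ID)).

Lemma ff_invariantP c : ff_invariant c <-> forall p q, violation c p q = false.
Proof.
split=> [inv p q|inv i p pi /emptybP cp [q [qi qc /zltP pq]]]; last first.
  have := inv p q; rewrite /layer /occupied in pi qi qc.
  by rewrite /violation cp qc pq pi qi eqxx.
apply/negP => /and4P[/emptybP cp qc /eqP sz /zltP pq].
by apply: (inv (size p) p) => //; exists q.
Qed.

Lemma sqr_pow2V (l : nat) : ((2 ^- l) ^+ 2 = 4 ^- l :> R)%R.
Proof.
have -> : (4 = 2 ^+ 2 :> R)%R by rewrite -GRing.natrX.
by rewrite GRing.exprVn -!GRing.exprM mulnC.
Qed.

Lemma square_volume (l : nat) (x : ID) : is_square side l x -> (volume side x = 4 ^- l)%R.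
Proof. by rewrite /volume => ->; apply: sqr_pow2V. Qed.

Lemma volume_square (l : nat) (x : ID) : (volume side x = 4 ^- l)%R -> is_square side l x.
Proof.
rewrite -sqr_pow2V => /eqP; rewrite Num.Theory.eqrXn2 // => [/eqP//||].
  exact/Order.POrderTheory.ltW/side_gt0.
by rewrite Num.Theory.invr_ge0 Num.Theory.exprn_ge0 ?Num.Theory.ler0n.
Qed.

Lemma card_covered (D : nat) (ps : seq pixel) : (forall p, p \in ps -> size p <= D) ->
  #|[set w : D.-tuple 'I_4 | has (nested w) ps]| <= \sum_(p <- ps) 4 ^ (D - size p).
Proof.
elim: ps => [|p ps IHps] psD /=.
  by rewrite big_nil leqn0 cards_eq0; apply/eqP/setP => w; rewrite !inE.
have pD : size p <= D by apply: psD; rewrite inE eqxx.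
rewrite big_cons -(card_tuple_prefix pD).
apply: (@leq_trans (#|[set w : D.-tuple 'I_4 | prefix p w]| +
                    #|[set w : D.-tuple 'I_4 | has (nested w) ps]|)); last first.
  by rewrite leq_add2l; apply: IHps => q qps; apply: psD; rewrite inE qps orbT.
apply: leq_trans (leq_card_setU _ _); apply/subset_leq_card/subsetP => w.
rewrite !inE => /orP[/orP[wp|->]|->]; rewrite ?orbT //.
by rewrite (prefix_size_eq wp) ?prefix_refl // size_tuple.
Qed.

Lemma depth_bound c : exists D, forall p, p \in domf c -> size p <= D.
Proof.
exists (\max_(p <- domf c) size p) => p pc.
exact: (leq_bigmax_seq (P := xpredT)).
Qed.

(** If no [l]-pixel were empty, [free_count_lt] for the whole square would leave less than [4 ^- l]
    free. Free area and squares fill the unit square, so the mass would exceed [1 - 4 ^- l]. *)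
Lemma insertion_room c (l : nat) : ff_invariant c ->
  (mass R c + 4 ^- l <= 1)%R -> exists2 p, size p = l & emptyb c p.
Proof.
move=> /ff_invariantP inv le1.
have [/existsP[t ct]|/existsPn full] := boolP [exists t : l.-tuple 'I_4, emptyb c t].
  by exists t; rewrite ?size_tuple.
have [D0 D0P] := depth_bound c; pose D := maxn l D0.
have lD : l <= D by apply: leq_maxl.
have cD p : p \in domf c -> size p <= D.
  by move=> /D0P pD; apply: leq_trans pD (leq_maxr _ _).
have free : free_count D c predT < 4 ^ (D - l).
  apply: free_count_lt => // [p r x cp _ rc sz pr _ _|p pl _].
    by have := inv p r; rewrite /violation cp rc sz eqxx pr.
  by move/eqP in pl; have := full (Tuple pl).
have cov := card_covered cD.
have total : 4 ^ D <= free_count D c predT + \sum_(p <- domf c) 4 ^ (D - size p).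
  apply: leq_trans (leq_add (leqnn _) cov); apply: leq_trans (leq_card_setU _ _).
  rewrite -[X in X ^ _](card_ord 4) -card_tuple -cardsT.
  apply/subset_leq_card/subsetP => w _; rewrite !inE andbT /emptyb.
  by rewrite -[X in _ || X]negbK -all_predC orbN.
have pow (k : nat) : k <= D -> ((4 ^ (D - k))%:R = 4 ^+ D * 4 ^- k :> R)%R.
  by move=> kD; rewrite GRing.natrX GRing.expfB_cond // Num.Theory.pnatr_eq0.
have massE : ((\sum_(p <- domf c) 4 ^ (D - size p))%:R = 4 ^+ D * mass R c :> R)%R.
  rewrite GRing.natr_sum /mass GRing.mulr_sumr big_seq [RHS]big_seq.
  by apply: eq_bigr => p /cD/pow.
exfalso; have : 4 ^ D < 4 ^ (D - l) + \sum_(p <- domf c) 4 ^ (D - size p) by lia.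
rewrite -(Num.Theory.ltr_nat R) GRing.natrD massE pow // -GRing.mulrDr GRing.natrX.
have D_gt0 : (0 < 4 ^+ D :> R)%R by rewrite Num.Theory.exprn_gt0 ?Num.Theory.ltr0n.
rewrite -[X in (X < _)%R]GRing.mulr1 Num.Theory.ltr_pM2l // GRing.addrC.
by rewrite Order.TotalTheory.ltNge le1.
Qed.

Record good s c : Prop := Good {
  good_config : is_configuration side c;
  good_inv : ff_invariant c;
  good_content : forall u, content c u <-> u \in present s;
  good_mass : mass R c = (\sum_(r <- s) request_volume side r)%R }.

Lemma good_nil : good [::] [fmap]%fmap.
Proof.
split=> [||u|].
- by split=> [p x|p q x|p q]; rewrite ?fnd_fmap0 // /occupied in_fset0.
- by move=> i p _ _ [q [_]]; rewrite /occupied in_fset0.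
- by rewrite in_fset0; split=> // -[p]; rewrite fnd_fmap0.
by rewrite /mass !big_nil.
Qed.

Lemma insert_good s c x c' : good s c -> x \notin present s ->
  ff_insert side c x c' -> good (rcons s (Insert x)) c' /\ no_square_moved c c'.
Proof.
case=> conf /ff_invariantP inv cont massE Nx [l [p [sq [[pl /emptybP cp] pmin] ->]]].
have pc := emptyb_notin cp.
have Ncx q : c.[? q]%fmap <> Some x.
  by move=> cq; case/negP: Nx; apply/cont; exists q.
split; last first.
  move=> q y cq; rewrite fnd_set; case: eqP => // qp.
  by move: pc; rewrite -qp (mem_fnd cq).
split.
- by apply: set_configuration; rewrite ?pl.
- apply/ff_invariantP => q r; apply/negP => /and4P[].
  rewrite emptyb_set mem_setf inE => /andP[cq _] /predU1P[->|rc] /eqP sz qr.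
    (* The new square causes no violation, because it takes the first empty pixel of its layer. *)
    apply: (pmin q); last exact/zltP.
    by rewrite -pl; split=> //; apply/emptybP.
  by have := inv q r; rewrite /violation cq rc sz eqxx qr.
- move=> u; rewrite /present -cats1 foldl_cat /= in_fset1U -/(present s).
  split=> [[q]|].
    rewrite fnd_set; case: eqP => [_ [->]|_ cq]; first by rewrite eqxx.
    by apply/orP; right; apply/cont; exists q.
  case/predU1P=> [->|/cont[q cq]]; first by exists p; rewrite fnd_set eqxx.
  exists q; rewrite fnd_set; case: eqP => // qp.
  by move: pc; rewrite -qp (mem_fnd cq).
rewrite mass_set // big_rcons massE /= (square_volume sq) -pl.
exact: GRing.addrC.
Qed.

(** Removing the square frees only space inside [p'], so all new violations are covered by [p']. *)
Lemma begin_inv c (D : nat) p p' : is_configuration side c -> ff_invariant c ->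
  (forall q, q \in domf c -> size q <= D) -> p \in domf c ->
  maximally_empty c.[~ p]%fmap p' -> prefix p' p ->
  outer_inv side D (content c.[~ p]%fmap) (mass R c.[~ p]%fmap) c.[~ p]%fmap [fset p']%fset.
Proof.
move=> conf /ff_invariantP inv cD pc maxp' p'p; set c1 := c.[~ p]%fmap.
have c1p' : emptyb c1 p' by apply/emptybP; case: maxp'.
have dom1 q : q \in domf c1 -> q \in domf c by rewrite mem_remf1 => /andP[].
have freed w : emptyb c1 w -> emptyb c w \/ prefix p' w.
  move=> c1w; have [wp|Nwp] := boolP (nested w p); last by left; apply: emptyb_rem Nwp.
  by right; apply: maximally_empty_prefix maxp' p'p c1w wp.
have before q r : zltb q r -> r \in domf c1 -> prefix p' q -> zltb p' r.
  move=> qr rc p'q; have /orP[//|p'r] := zltb_ancestorl p'q qr.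
  by have := emptyb_nested c1p' rc; rewrite /nested p'r.
have few q : q \in domf c -> free_count D c (zltb^~ q) < 4 ^ (D - size q).
  (* With the root in the role of [a], tidiness is the invariant itself. *)
  move=> qc; apply: leq_ltn_trans (_ : free_count D c (fun w => prefix [::] w && zltb w q) < _).
    by apply: free_count_le => w -> ->; rewrite prefix0s.
  apply: tidy_free_count => //; rewrite ?prefix0s ?orbT //.
  - by move=> u v; rewrite inv.
  - exact: cD.
  move=> u sz _ uq; apply/negP => cu; have := inv u q.
  by rewrite /violation cu qc sz eqxx uq.
split.
- split=> //; first exact: rem_configuration.
  by move=> q /dom1/cD.
- move=> q r /and4P[c1q rc sz qr]; have [cq|p'q] := freed q c1q.
    by have := inv q r; rewrite /violation cq (dom1 r rc) sz qr.
  by exists p'; split; rewrite ?inE //; apply: before qr rc p'q.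
- by move=> u v; rewrite !inE => /eqP-> /eqP->; rewrite eqxx.
- move=> u q v; rewrite inE => /eqP-> qc p'q.
  by have := emptyb_nested c1p' qc; rewrite /nested p'q.
move=> q qc; have lt_few := few q (dom1 q qc); have [p'q|Np'q] := boolP (zltb p' q).
  (* Outside [p'] nothing was freed, so the bound from before the deletion persists. *)
  right; exists p'; split=> //; apply: leq_ltn_trans lt_few.
  by apply: free_count_le => w /freed[-> /andP[]//|->]; rewrite andbF.
left; rewrite /few_before mul2n -addnn; apply: leq_ltn_trans (ltn_addr _ lt_few).
apply: free_count_le => w /freed[->//|p'w wq].
by rewrite (before _ _ wq qc p'w) in Np'q.
Qed.

Lemma begin_step_inv c (D : nat) x st : is_configuration side c -> ff_invariant c ->
  (forall q, q \in domf c -> size q <= D) -> step (Begin c x) st ->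
  exists2 p, c.[? p]%fmap = Some x &
    state_inv side D (content c.[~ p]%fmap) (mass R c.[~ p]%fmap) st.
Proof.
move=> conf inv cD stp; move: {-2}(Begin c x) (erefl (Begin c x)) stp => st0 + stp.
case: stp => // d y p p' dp maxp' p'p [dc yx].
rewrite {}dc {}yx in dp maxp' *; exists p => //.
exact: (begin_inv conf inv cD (mem_fnd dp) maxp' p'p).
Qed.

Lemma delete_terminates c x : is_configuration side c -> ff_invariant c ->
  content c x -> terminates (Begin c x).
Proof.
move=> conf inv [p cp]; have [D cD] := depth_bound c; apply: terminates_step.
  have [p' [maxp' p'p]] := maximally_emptyP (emptyb_rem_self (config_antichain conf) (mem_fnd cp)).
  by exists (Outer c.[~ p]%fmap [fset p']%fset); apply: step_begin cp maxp' p'p.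
by move=> st /(begin_step_inv conf inv cD)[q _ /state_terminates].
Qed.

Lemma delete_good s c x c' : good s c -> ff_delete c x c' -> good (rcons s (Delete x)) c'.
Proof.
case=> conf inv cont massE run0; have run := clos_rt_rt1n _ _ _ _ run0.
have [D cD] := depth_bound c.
have [st stp run'] : exists2 st, step (Begin c x) st &
    clos_refl_trans (state ID) (@step ID) st (Outer c' fset0).
  inversion run as [|st st' stp run']; subst; exists st => //.
  exact: clos_rt1n_rt.
have [p cp st_inv] := begin_step_inv conf inv cD stp.
have [[conf' _ cont' mass'] cov _ _ _] := run_state_inv st_inv run'.
split=> //.
(* At the end the set is empty and covers nothing, so no violation is left. *)
- by apply/ff_invariantP => q r; apply/negP => /cov[z []]; rewrite in_fset0.
- move=> u; rewrite cont' /present -cats1 foldl_cat /= -/(present s) in_fsetD1.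
  split=> [[q]|/andP[ux /cont[q cq]]]; last first.
    exists q; rewrite fnd_rem1; case: eqP => //= qp.
    by move: cq ux; rewrite qp cp => -[->]; rewrite eqxx.
  rewrite fnd_rem1; case: eqVneq => //= qp cq; apply/andP; split; last first.
    by apply/cont; exists q.
  apply: contraNneq qp => ux; rewrite ux in cq; case: conf => _ inj _.
  by rewrite (inj _ _ _ cq cp).
rewrite mass' big_rcons -massE /= (mass_rem R (mem_fnd cp)).
have -> : volume side x = (4 ^- size p)%R.
  by apply: square_volume; case: conf => sq _ _; apply: sq.
by rewrite /= GRing.addrAC GRing.addrN GRing.add0r.
Qed.

End Requests.

(** * Runs of requests *)

Import Order.TTheory GRing.Theory Num.Theory.

Local Open Scope ring_scope.

Lemma good_request (R : realFieldType) (ID : choiceType) (side : ID -> R)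
    (s : seq (request ID)) (r : request ID) (c c' : config ID) :
  good side s c -> refers_properly s r -> ff_request side c r c' ->
  good side (rcons s r) c'.
Proof.
case: r => x gd; first by move=> Nx /(insert_good gd Nx)[].
by move=> _; apply: delete_good.
Qed.

Lemma good_run (R : realFieldType) (ID : choiceType) (side : ID -> R)
    (reqs s t : seq (request ID)) (c : config ID) :
  valid side reqs -> ff_run side s c -> reqs = s ++ t -> good side s c.
Proof.
case=> proper _ run; elim: run t => [|{}s {}c r c' _ IH req] t.
  by move=> _; apply: good_nil.
rewrite cat_rcons => reqsE; apply: good_request req; first exact: IH reqsE.
exact: proper reqsE.
Qed.

Theorem theorem6 (R : realFieldType) (ID : choiceType) (side : ID -> R)
    (side_gt0 : forall x : ID, 0 < side x) (reqs : seq (request ID)) :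
  valid side reqs -> aligned side reqs ->
  forall (s : seq (request ID)) (r : request ID) (t : seq (request ID)),
    reqs = s ++ r :: t ->
  forall c : config ID, ff_run side s c ->
  [/\ (exists c' : config ID, ff_request side c r c'),
      (forall x : ID, r = Insert x ->
         (forall l : nat, is_square side l x ->
            exists p : pixel, layer p = l /\ empty c p) /\
         (forall c' : config ID, ff_request side c r c' ->
            no_square_moved c c')),
      (forall x : ID, r = Delete x -> terminates (Begin c x)) &
      (forall c' : config ID, ff_request side c r c' ->
         is_configuration side c' /\ ff_invariant c')].
Proof.
move=> val ali s r t reqsE c run.
have gd := good_run val run reqsE; have [conf inv cont massE] := gd.
have proper := val.1 _ _ _ reqsE; have [l0 vol] := ali _ _ _ reqsE.
have room x l : r = Insert x -> is_square side l x ->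
    exists p, layer p = l /\ emptyb c p.
  move=> rx sq; have [|p pl cp] := @insertion_room R ID c l inv; last by exists p.
  (* The prefix sum that includes the current request bounds the present mass plus the new
     volume. *)
  have := val.2 (size s).+1; rewrite reqsE -cat_rcons take_size_cat ?size_rcons //.
  by rewrite big_rcons /= massE rx /= (square_volume sq).
have term x : r = Delete x -> terminates (Begin c x).
  move=> rx; apply: delete_terminates conf inv _.
  by apply/cont; rewrite rx in proper.
split=> //.
- case: r => x in proper vol room term reqsE *.
    have sq : is_square side l0 x.
      apply: volume_square => //; rewrite -vol /=.
      by rewrite ger0_norm // exprn_ge0 // ltW.
    have [p [pl cp]] := room x l0 erefl sq.
    have [q [[ql cq] qmin]] := @exists_z_first (emptyb c) l0 (ex_intro2 _ _ p pl cp).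
    exists c.[q <- x]%fmap, l0, q; split=> //.
    by split=> [|u [ul /emptybP cu]]; [split=> //; apply/emptybP|apply: qmin].
  by have [c' run'] := terminates_run (term x erefl); exists c'.
- move=> x rx; split=> [l sq|c'].
    by have [p [pl cp]] := room x l rx sq; exists p; split=> //; apply/emptybP.
  by rewrite rx in proper * => /(insert_good gd proper)[].
by move=> c' /(good_request gd proper)[].
Qed.
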